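(* Let $-\infty \le a < b \le \infty$, let $p : (a,b) \to \mathbb{R}$ be continuous, and let $u(x) > 0$ be a positive solution on $(a,b)$ of $$u'' + p(x)\,u = 0 .$$ Let $a < x_0 < b$ and assume that at least one of the integrals $$L_1 := \int_a^{x_0} \frac{dt}{u^2(t)}, \qquad L_2 := \int_{x_0}^b \frac{dt}{u^2(t)}$$ is finite. Then: (a) There exists a continuous function $P : (a,b) \to \mathbb{R}$ with $P(x) > p(x)$ for all $x \in (a,b)$ such that the conclusion of the Sturm Comparison Theorem on $(a,b)$ does not hold for the pair of equations $u'' + p(x)u = 0$ and $v'' + P(x)v = 0$; that is, some real solution $v$ of $v'' + P(x)\,v = 0$ on $(a,b)$ has no zero in $(a,b)$. (b) The conclusion of the Sturm Separation Theorem does not hold for the equation $u'' + p(x)u = 0$ on $(a,b)$; that is, there exists a real solution of $u'' + p(x)\,u = 0$ on $(a,b)$ which is linearly independent of the given solution $u$ and has no zero in $(a,b)$.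
   Context: Solutions are real-valued, twice differentiable functions on the open interval $(a,b)$. The coefficient functions are continuous on the open interval $(a,b)$ but need not be continuous or bounded at its endpoints. The conclusion of the Sturm Comparison Theorem on $(a,b)$ is: every solution of $v'' + P(x)v = 0$ has a zero in the open interval $(a,b)$. The conclusion of the Sturm Separation Theorem on $(a,b)$ for a solution $u$ is: every solution of the same equation that is linearly independent of $u$ has a zero in the open interval $(a,b)$. *)

(* Defs.v *)
(* Stdlib reals with Coquelicot. *)
From Stdlib Require Import Reals.
From Coquelicot Require Import Coquelicot.
Open Scope R_scope.

Definition in_interval (a b : Rbar) (x : R) : Prop := Rbar_lt a x /\ Rbar_lt x b.

Definition continuous_on_interval (a b : Rbar) (f : R -> R) : Prop :=
  forall x, in_interval a b x -> continuous f x.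

(* Functions on (a,b) are represented by total functions whose values outside
   (a,b) are irrelevant.  Since [Derive] is total, [ex_derive_n y 2 x] alone
   would not give the differentiability of [y]: it is required separately. *)
Definition is_solution (a b : Rbar) (q y : R -> R) : Prop :=
  forall x, in_interval a b x ->
    ex_derive y x /\ ex_derive_n y 2 x /\ Derive_n y 2 x + q x * y x = 0.

Definition linearly_independent_on (a b : Rbar) (f g : R -> R) : Prop :=
  forall c d : R,
    (forall x, in_interval a b x -> c * f x + d * g x = 0) -> c = 0 /\ d = 0.

(* One-sided neighbourhoods of an extended real; the bound may be infinite,
   e.g. [Rbar_at_right m_infty] is [Rbar_locally m_infty]. *)
Definition Rbar_at_right (a : Rbar) : (R -> Prop) -> Prop :=
  within (fun x : R => Rbar_lt a x) (Rbar_locally a).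

Definition Rbar_at_left (b : Rbar) : (R -> Prop) -> Prop :=
  within (fun x : R => Rbar_lt x b) (Rbar_locally b).

(* Convergence of improper integrals at the endpoint a, resp. b; for a
   nonnegative continuous integrand this is finiteness of the integral. *)
Definition finite_integral_from (a : Rbar) (x0 : R) (f : R -> R) : Prop :=
  ex_RInt_gen f (Rbar_at_right a) (at_point x0).

Definition finite_integral_to (x0 : R) (b : Rbar) (f : R -> R) : Prop :=
  ex_RInt_gen f (at_point x0) (Rbar_at_left b).

(* Main.v *)
Require Import Defs.
From Stdlib Require Import Reals Lra.
From Coquelicot Require Import Coquelicot.
Open Scope R_scope.

(** Let [G] be an antiderivative of [1 / u ^ 2] or of [- 1 / u ^ 2].  For any
    twice differentiable [h], the terms in [u'] cancel when [u * h(G)] is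
    differentiated twice, and
      [(u h(G))'' = u'' h(G) + h''(G) / u ^ 3],
    so that, where [h > 0], [u * h(G)] solves [v'' + P v = 0] with
    [P = p - h''(G) / (u ^ 4 h(G))] ([solution_composed_with_antiderivative]).

    Finiteness of one of the two integrals says exactly that the antiderivative
    vanishing at [x0] is bounded on one side, so that after adding a constant
    (and changing its sign if the bound is from above) it becomes positive on
    the whole interval ([positive_antiderivative]).  With a positive [G]:
    - [h = sqrt] is positive and strictly concave, hence [v = u * sqrt G] has no
      zero and [P = p + 1 / (4 u ^ 4 G ^ 2) > p];
    - [h = id] has [h'' = 0], hence [w = u * G] is a second solution of the
      original equation; it has no zero, and it is independent of [u] because
      [G] is not constant. *)

(** * The open interval and one-sided neighbourhoods of its endpoints *)

Lemma locally_in_interval (a b : Rbar) (x : R) :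
  in_interval a b x -> locally x (in_interval a b).
Proof.
  intros [ha hb].
  apply filter_and; [apply (open_Rbar_gt' x a ha) | apply (open_Rbar_lt' x b hb)].
Qed.

Lemma in_interval_between (a b : Rbar) (x y z : R) :
  in_interval a b x -> in_interval a b y -> Rmin x y <= z <= Rmax x y ->
  in_interval a b z.
Proof.
  intros [hax hxb] [hay hyb] [hz1 hz2]; split.
  - apply Rbar_lt_le_trans with (Rmin x y); [|exact hz1].
    unfold Rmin; destruct (Rle_dec x y); assumption.
  - apply Rbar_le_lt_trans with (Rmax x y); [exact hz2|].
    unfold Rmax; destruct (Rle_dec x y); assumption.
Qed.

Lemma Rbar_at_right_point (a : Rbar) (Q : R -> Prop) (x : R) :
  Rbar_at_right a Q -> Rbar_lt a x ->
  exists y : R, Q y /\ Rbar_lt a y /\ y < x.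
Proof.
  unfold Rbar_at_right, within; intros hQ hax.
  pose proof (filter_and _ _ hQ (open_Rbar_lt' a x hax)) as H.
  destruct a as [a| |]; simpl in H.
  - destruct H as [e He].
    exists (a + e / 2); pose proof (cond_pos e) as he.
    destruct (He (a + e / 2)) as [H1 H2].
    { apply Rabs_def1; unfold minus, plus, opp; simpl; lra. }
    assert (hay : a < a + e / 2) by lra.
    exact (conj (H1 hay) (conj hay H2)).
  - destruct hax.
  - destruct H as [M HM].
    destruct (HM (M - 1)) as [H1 H2]; [lra|].
    exists (M - 1); exact (conj (H1 I) (conj I H2)).
Qed.

Lemma Rbar_at_left_point (b : Rbar) (Q : R -> Prop) (x : R) :
  Rbar_at_left b Q -> Rbar_lt x b ->
  exists y : R, Q y /\ Rbar_lt y b /\ x < y.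
Proof.
  unfold Rbar_at_left, within; intros hQ hxb.
  pose proof (filter_and _ _ hQ (open_Rbar_gt' b x hxb)) as H.
  destruct b as [b| |]; simpl in H.
  - destruct H as [e He].
    exists (b - e / 2); pose proof (cond_pos e) as he.
    destruct (He (b - e / 2)) as [H1 H2].
    { apply Rabs_def1; unfold minus, plus, opp; simpl; lra. }
    assert (hyb : b - e / 2 < b) by lra.
    exact (conj (H1 hyb) (conj hyb H2)).
  - destruct H as [M HM].
    destruct (HM (M + 1)) as [H1 H2]; [lra|].
    exists (M + 1); exact (conj (H1 I) (conj I H2)).
  - destruct hxb.
Qed.

(** * A positive antiderivative *)

Section Antiderivative.

Variables (a b : Rbar) (f : R -> R) (x0 : R).
Hypothesis f_cont : continuous_on_interval a b f.
Hypothesis f_ge0 : forall x, in_interval a b x -> 0 <= f x.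
Hypothesis x0_in : in_interval a b x0.

Lemma ex_RInt_in_interval (x y : R) :
  in_interval a b x -> in_interval a b y -> ex_RInt f x y.
Proof.
  intros hx hy; apply (ex_RInt_continuous (V := R_CompleteNormedModule)).
  intros z hz; apply f_cont, (in_interval_between a b x y z hx hy hz).
Qed.

Lemma is_derive_RInt_in_interval (x : R) :
  in_interval a b x -> is_derive (fun y => RInt f x0 y) x (f x).
Proof.
  intros hx; apply (is_derive_RInt f (fun y => RInt f x0 y) x0).
  - apply filter_imp with (2 := locally_in_interval a b x hx).
    intros y hy; apply (RInt_correct f), ex_RInt_in_interval; assumption.
  - exact (f_cont x hx).
Qed.

Lemma RInt_nondecreasing (x y : R) :
  in_interval a b x -> in_interval a b y -> x <= y ->
  RInt f x0 x <= RInt f x0 y.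
Proof.
  intros hx hy hxy.
  pose proof (RInt_Chasles f x0 x y (ex_RInt_in_interval x0 x x0_in hx)
    (ex_RInt_in_interval x y hx hy)) as H.
  unfold plus in H; simpl in H.
  assert (0 <= RInt f x y).
  { apply RInt_ge_0; [exact hxy | apply ex_RInt_in_interval; assumption |].
    intros z hz; apply f_ge0, (in_interval_between a b x y z hx hy).
    rewrite Rmin_left, Rmax_right; lra. }
  lra.
Qed.

(** Near [a] the integrals up to [x0] stay within distance 1 of their limit
    [l]; monotonicity carries the resulting bound to the whole interval. *)
Lemma RInt_bounded_below :
  finite_integral_from a x0 f ->
  exists K, forall x, in_interval a b x -> 0 < K + RInt f x0 x.
Proof.
  intros [l Hl].
  destruct (Hl _ (locally_ball l (mkposreal 1 Rlt_0_1))) as [Q S hQ hS HQS].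
  exists (l + 1); intros x hx.
  destruct (Rbar_at_right_point a Q x hQ (proj1 hx)) as (y & hy & hay & hyx).
  assert (hyi : in_interval a b y).
  { split; [exact hay|]. apply Rbar_lt_trans with x; [exact hyx | apply hx]. }
  destruct (HQS y x0 hy hS) as (J & HJ & HB).
  apply (is_RInt_unique f y x0 J) in HJ.
  apply Rabs_def2 in HB; unfold minus, plus, opp in HB; simpl in HB.
  pose proof (opp_RInt_swap f y x0 (ex_RInt_in_interval y x0 hyi x0_in)) as Hs.
  unfold opp in Hs; simpl in Hs.
  pose proof (RInt_nondecreasing y x hyi hx (Rlt_le _ _ hyx)).
  lra.
Qed.

Lemma RInt_bounded_above :
  finite_integral_to x0 b f ->
  exists K, forall x, in_interval a b x -> 0 < K - RInt f x0 x.
Proof.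
  intros [l Hl].
  destruct (Hl _ (locally_ball l (mkposreal 1 Rlt_0_1))) as [S Q hS hQ HSQ].
  exists (l + 1); intros x hx.
  destruct (Rbar_at_left_point b Q x hQ (proj2 hx)) as (y & hy & hyb & hxy).
  assert (hyi : in_interval a b y).
  { split; [|exact hyb]. apply Rbar_lt_trans with x; [apply hx | exact hxy]. }
  destruct (HSQ x0 y hS hy) as (J & HJ & HB).
  apply (is_RInt_unique f x0 y J) in HJ.
  apply Rabs_def2 in HB; unfold minus, plus, opp in HB; simpl in HB.
  pose proof (RInt_nondecreasing x y hx hyi (Rlt_le _ _ hxy)).
  lra.
Qed.

(** With [K] the bound on the antiderivative [F] vanishing at [x0], finiteness
    at [a] gives [G = K + F] and [s = 1], finiteness at [b] gives [G = K - F] and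
    [s = -1].  The sign is recorded as [s * s = 1] so that the two cases can be
    treated together: it enters the second derivative of [u h(G)] squared. *)
Lemma positive_antiderivative :
  finite_integral_from a x0 f \/ finite_integral_to x0 b f ->
  exists (s : R) (G : R -> R),
    s * s = 1 /\
    forall x, in_interval a b x -> 0 < G x /\ is_derive G x (s * f x).
Proof.
  intros [h | h].
  - destruct (RInt_bounded_below h) as [K HK].
    exists 1, (fun x => K + RInt f x0 x); split; [ring|].
    intros x hx; split; [exact (HK x hx)|].
    replace (1 * f x) with (plus 0 (f x)) by (unfold plus; simpl; ring).
    apply (is_derive_plus (fun _ => K) (RInt f x0)); [exact (is_derive_const K x)|].
    exact (is_derive_RInt_in_interval x hx).
  - destruct (RInt_bounded_above h) as [K HK].
    exists (-1), (fun x => K - RInt f x0 x); split; [ring|].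
    intros x hx; split; [exact (HK x hx)|].
    replace (-1 * f x) with (minus 0 (f x))
      by (unfold minus, plus, opp; simpl; ring).
    apply (is_derive_minus (fun _ => K) (RInt f x0)); [exact (is_derive_const K x)|].
    exact (is_derive_RInt_in_interval x hx).
Qed.

End Antiderivative.

(** * Solutions of the form [u * h(G)] *)

Lemma is_solution_of_derivatives (a b : Rbar) (q y y1 y2 : R -> R) :
  (forall x, in_interval a b x -> is_derive y x (y1 x)) ->
  (forall x, in_interval a b x -> is_derive y1 x (y2 x)) ->
  (forall x, in_interval a b x -> y2 x + q x * y x = 0) ->
  is_solution a b q y.
Proof.
  intros h1 h2 hq x hx.
  assert (H : is_derive (Derive y) x (y2 x)).
  { apply is_derive_ext_loc with y1; [|exact (h2 x hx)].
    apply filter_imp with (2 := locally_in_interval a b x hx).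
    intros z hz; symmetry; apply is_derive_unique, h1, hz. }
  split; [exists (y1 x); exact (h1 x hx)|].
  split; [exists (y2 x); exact H|].
  simpl; replace (Derive _ x) with (y2 x); [exact (hq x hx)|].
  symmetry; exact (is_derive_unique _ _ _ H).
Qed.

Lemma is_solution_derivatives (a b : Rbar) (q y : R -> R) :
  is_solution a b q y ->
  exists y1 : R -> R, forall x, in_interval a b x ->
    is_derive y x (y1 x) /\ is_derive y1 x (- q x * y x).
Proof.
  intros hy; exists (Derive y); intros x hx.
  destruct (hy x hx) as (d1 & d2 & eqy).
  split; [apply Derive_correct, d1|].
  replace (- q x * y x) with (Derive (Derive y) x);
    [apply Derive_correct; exact d2|].
  change (Derive (Derive y) x + q x * y x = 0) in eqy; lra.
Qed.

Lemma is_solution_ext_coeff (a b : Rbar) (q q' y : R -> R) :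
  (forall x, in_interval a b x -> q x = q' x) ->
  is_solution a b q y -> is_solution a b q' y.
Proof.
  intros hq hy x hx; rewrite <- (hq x hx); exact (hy x hx).
Qed.

(** The first derivative of [u h(G)] is [u' h(G) + s h'(G) / u].  Differentiating
    again, [u' (h(G))' = s u' h'(G) / u ^ 2] cancels against
    [s h'(G) (1 / u)'], which leaves [u'' h(G) + s ^ 2 h''(G) / u ^ 3]. *)
Lemma solution_composed_with_antiderivative
    (a b : Rbar) (p u G h h1 h2 : R -> R) (s : R) :
  is_solution a b p u ->
  (forall x, in_interval a b x -> 0 < u x) ->
  s * s = 1 ->
  (forall x, in_interval a b x ->
     0 < G x /\ is_derive G x (s * (1 / u x ^ 2))) ->
  (forall t, 0 < t ->
     0 < h t /\ is_derive h t (h1 t) /\ is_derive h1 t (h2 t)) ->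
  is_solution a b (fun x => p x - h2 (G x) / (u x ^ 4 * h (G x)))
    (fun x => u x * h (G x)).
Proof.
  intros hu hpos hs hG hh.
  destruct (is_solution_derivatives a b p u hu) as [u1 hu1].
  apply is_solution_of_derivatives with
    (y1 := fun x => u1 x * h (G x) + s * h1 (G x) / u x)
    (y2 := fun x => - p x * u x * h (G x) + h2 (G x) / u x ^ 3).
  - intros x hx.
    destruct (hu1 x hx) as [du _]; pose proof (hpos x hx).
    destruct (hG x hx) as [g0 dG]; destruct (hh _ g0) as (_ & dh & _).
    auto_derive.
    + repeat split; first
        [ exists (u1 x); exact du | exists (h1 (G x)); exact dh
        | exists (s * (1 / u x ^ 2)); exact dG ].
    + rewrite (is_derive_unique _ _ _ dG : Derive (fun x => G x) x = _).
      rewrite (is_derive_unique _ _ _ du : Derive (fun x => u x) x = _).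
      rewrite (is_derive_unique _ _ _ dh : Derive (fun x => h x) (G x) = _).
      field; lra.
  - intros x hx.
    destruct (hu1 x hx) as [du du1]; pose proof (hpos x hx).
    destruct (hG x hx) as [g0 dG]; destruct (hh _ g0) as (_ & dh & dh1).
    auto_derive.
    + repeat split; first
        [ exists (u1 x); exact du | exists (- p x * u x); exact du1
        | exists (h1 (G x)); exact dh | exists (h2 (G x)); exact dh1
        | exists (s * (1 / u x ^ 2)); exact dG | lra ].
    + rewrite (is_derive_unique _ _ _ dG : Derive (fun x => G x) x = _).
      rewrite (is_derive_unique _ _ _ du : Derive (fun x => u x) x = _).
      rewrite (is_derive_unique _ _ _ du1 : Derive (fun x => u1 x) x = _).
      rewrite (is_derive_unique _ _ _ dh : Derive (fun x => h x) (G x) = _).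
      rewrite (is_derive_unique _ _ _ dh1 : Derive (fun x => h1 x) (G x) = _).
      replace (h2 (G x) / u x ^ 3) with (s * s * h2 (G x) / u x ^ 3)
        by (rewrite hs; field; lra).
      field; lra.
  - intros x hx; pose proof (hpos x hx).
    destruct (hG x hx) as [g0 _]; destruct (hh _ g0) as (h0 & _).
    simpl; field; lra.
Qed.

Lemma is_solution_scaled_by_sqrt (a b : Rbar) (p u G : R -> R) (s : R) :
  is_solution a b p u ->
  (forall x, in_interval a b x -> 0 < u x) ->
  s * s = 1 ->
  (forall x, in_interval a b x ->
     0 < G x /\ is_derive G x (s * (1 / u x ^ 2))) ->
  is_solution a b (fun x => p x + 1 / (4 * u x ^ 4 * G x ^ 2))
    (fun x => u x * sqrt (G x)).
Proof.
  intros hu hpos hs hG.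
  eapply is_solution_ext_coeff; cycle 1.
  - apply (solution_composed_with_antiderivative a b p u G sqrt
      (fun t => / (2 * sqrt t)) (fun t => - / (4 * t * sqrt t)) s); try assumption.
    intros t ht; pose proof (sqrt_lt_R0 t ht) as hst.
    pose proof (sqrt_sqrt t (Rlt_le _ _ ht)) as hss.
    split; [exact hst|]; split.
    + auto_derive; [exact ht | field; lra].
    + auto_derive; [split; [exact ht | split; [lra | exact I]]|].
      (* Written in [r = sqrt t], with [t = r * r], the identity is rational. *)
      set (r := sqrt t) in *; rewrite <- hss; field; lra.
  - intros x hx; pose proof (hpos x hx); destruct (hG x hx) as [g0 _].
    pose proof (sqrt_lt_R0 _ g0) as hst.
    pose proof (sqrt_sqrt _ (Rlt_le _ _ g0)) as hss.
    simpl; set (r := sqrt (G x)) in *; rewrite <- hss; field; lra.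
Qed.

Lemma is_solution_scaled (a b : Rbar) (p u G : R -> R) (s : R) :
  is_solution a b p u ->
  (forall x, in_interval a b x -> 0 < u x) ->
  s * s = 1 ->
  (forall x, in_interval a b x ->
     0 < G x /\ is_derive G x (s * (1 / u x ^ 2))) ->
  is_solution a b p (fun x => u x * G x).
Proof.
  intros hu hpos hs hG.
  eapply is_solution_ext_coeff; cycle 1.
  - apply (solution_composed_with_antiderivative a b p u G (fun t => t)
      (fun _ => 1) (fun _ => 0) s); try assumption.
    intros t ht; split; [exact ht|].
    split; [apply (is_derive_id t) | apply (is_derive_const 1 t)].
  - intros x hx; pose proof (hpos x hx); destruct (hG x hx) as [g0 _].
    simpl; field; lra.
Qed.

(** If [c u + d u G = 0] then [c + d G = 0] since [u > 0]; differentiating at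
    one point gives [d = 0]. *)
Lemma linearly_independent_scaled (a b : Rbar) (u G : R -> R) (x0 l : R) :
  in_interval a b x0 ->
  (forall x, in_interval a b x -> 0 < u x) ->
  is_derive G x0 l -> l <> 0 ->
  linearly_independent_on a b u (fun x => u x * G x).
Proof.
  intros hx0 hpos dG hl c d hcd.
  assert (hG : forall x, in_interval a b x -> c + d * G x = 0).
  { intros x hx; pose proof (hpos x hx).
    apply Rmult_eq_reg_l with (u x); [|lra].
    rewrite Rmult_0_r, <- (hcd x hx); ring. }
  assert (d1 : is_derive (fun x => c + d * G x) x0 (d * l)).
  { auto_derive; [exists l; exact dG|].
    rewrite (is_derive_unique _ _ _ dG : Derive (fun x => G x) x0 = _); ring. }
  assert (d2 : is_derive (fun x => c + d * G x) x0 0).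
  { apply is_derive_ext_loc with (fun _ => 0); [|apply (is_derive_const 0 x0)].
    apply filter_imp with (2 := locally_in_interval a b x0 hx0).
    intros x hx; symmetry; exact (hG x hx). }
  assert (hd : d * l = 0).
  { rewrite <- (is_derive_unique _ _ _ d1); exact (is_derive_unique _ _ _ d2). }
  destruct (Rmult_integral _ _ hd) as [-> | hl0]; [|contradiction].
  split; [|reflexivity].
  pose proof (hG x0 hx0); lra.
Qed.

(** * Failure of comparison and separation *)

Theorem mainTheorem3 (a b : Rbar) (p u : R -> R) (x0 : R)
    (hab : Rbar_lt a b)
    (hp : continuous_on_interval a b p)
    (hu : is_solution a b p u)
    (hu_pos : forall x, in_interval a b x -> 0 < u x)
    (hx0 : in_interval a b x0)
    (hL : finite_integral_from a x0 (fun t => 1 / (u t) ^ 2) \/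
          finite_integral_to x0 b (fun t => 1 / (u t) ^ 2)) :
  (exists P : R -> R,
      continuous_on_interval a b P /\
      (forall x, in_interval a b x -> p x < P x) /\
      exists v : R -> R,
        is_solution a b P v /\
        forall x, in_interval a b x -> v x <> 0) /\
  (exists w : R -> R,
      is_solution a b p w /\
      linearly_independent_on a b u w /\
      forall x, in_interval a b x -> w x <> 0).
Proof.
  destruct (positive_antiderivative a b (fun t => 1 / u t ^ 2) x0)
    as (s & G & hs & hG); [| |exact hx0|exact hL|].
  { intros x hx; pose proof (hu_pos x hx).
    apply (ex_derive_continuous (fun t => 1 / u t ^ 2)).
    auto_derive; split; [apply (hu x hx) | split; [nra | exact I]]. }
  { intros x hx; pose proof (hu_pos x hx).
    apply Rlt_le, Rdiv_lt_0_compat; [lra | apply pow_lt; assumption]. }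
  split.
  - exists (fun x => p x + 1 / (4 * u x ^ 4 * G x ^ 2)).
    split; [|split].
    + intros x hx; pose proof (hu_pos x hx); destruct (hG x hx) as [g0 dG].
      apply (continuous_plus p); [exact (hp x hx)|].
      apply (ex_derive_continuous (fun t => 1 / (4 * u t ^ 4 * G t ^ 2))).
      auto_derive; repeat split; first
        [ apply (hu x hx) | exists (s * (1 / u x ^ 2)); exact dG
        | apply Rgt_not_eq; repeat apply Rmult_lt_0_compat; lra ].
    + intros x hx; pose proof (hu_pos x hx); destruct (hG x hx) as [g0 _].
      assert (0 < 1 / (4 * u x ^ 4 * G x ^ 2)); [|lra].
      apply Rdiv_lt_0_compat; [lra|].
      repeat apply Rmult_lt_0_compat; try apply pow_lt; lra.
    + exists (fun x => u x * sqrt (G x)); split.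
      * exact (is_solution_scaled_by_sqrt a b p u G s hu hu_pos hs hG).
      * intros x hx; apply Rgt_not_eq, Rmult_lt_0_compat; [exact (hu_pos x hx)|].
        apply sqrt_lt_R0, (hG x hx).
  - exists (fun x => u x * G x); split; [|split].
    + exact (is_solution_scaled a b p u G s hu hu_pos hs hG).
    + apply (linearly_independent_scaled a b u G x0 (s * (1 / u x0 ^ 2)));
        [exact hx0 | exact hu_pos | apply (hG x0 hx0) |].
      pose proof (hu_pos x0 hx0).
      apply Rmult_integral_contrapositive; split; [nra|].
      apply Rgt_not_eq, Rdiv_lt_0_compat; [lra | apply pow_lt; assumption].
    + intros x hx; apply Rgt_not_eq, Rmult_lt_0_compat;
        [exact (hu_pos x hx) | apply (hG x hx)].
Qed.
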